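(* For every $k \geq 1$ the irreducible representation $V_k = \mathrm{Sym}^k \mathbf{C}^2$ of $\mathrm{SL}_2(\mathbf{C})$ is transversal, and consequently $\mathsf{C}(V_k) = 1$.
   Context: Let a group $H$ act linearly on a finite-dimensional complex vector space $V$. The representation $V$ is called transversal if for every pair of subspaces $W, U \leq V$ there is some $g \in H$ with $$\dim(W \cap g\cdot U) = \max(0, \dim W + \dim U - \dim V).$$ For a nonzero subspace $U \leq V$, the group-additive diameter is $$\mathrm{diam}_+^{H}(V,U) = \min\{ m \mid g_1\cdot U + \dots + g_m\cdot U = V \text{ for some } g_1,\dots,g_m \in H\}.$$ If $H$ acts irreducibly on $V$, put $\mathsf{R}(V,U) = \mathrm{diam}_+^{H}(V,U) / \lceil \dim V/\dim U\rceil$, and the covering complexity of $V$ (with respect to $H$) is $\mathsf{C}(V) = \max_{0 \neq U \leq V} \mathsf{R}(V,U)$. In the claim $H = \mathrm{SL}_2(\mathbf{C})$. *)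

(* Defs.v *)
From HB Require Import structures.
From mathcomp Require Import all_boot all_order all_algebra.
From mathcomp Require Import boolp classical_sets reals.
From mathcomp Require Import complex.
From mathcomp.multinomials Require Import mpoly.

Set Implicit Arguments.
Unset Strict Implicit.
Unset Printing Implicit Defensive.

Import Order.TTheory GRing.Theory Num.Theory.

Local Open Scope ring_scope.

Record linrep (F : fieldType) (H : groupType) (V : vectType F) := LinRep {
  linrep_fun :> H -> 'End(V);
  linrep1 : linrep_fun 1%g = \1%VF;
  linrepM : forall g h : H,
    linrep_fun (g * h)%g = (linrep_fun g \o linrep_fun h)%VF
}.

Section Representations.

Variables (F : fieldType) (H : groupType) (V : vectType F).
Variable rho : linrep H V.

Definition irreducible_rep : Prop :=
  fullv != 0%VS :> {vspace V} /\
  forall U : {vspace V}, (forall g, (rho g @: U <= U)%VS) ->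
    U = 0%VS \/ U = fullv.

(* The subtraction is truncated, so it already takes the maximum with 0. *)
Definition transversal_rep : Prop :=
  forall W U : {vspace V}, exists g : H,
    \dim (W :&: rho g @: U) = (\dim W + \dim U - \dim {:V})%N.

Definition translates_cover (U : {vspace V}) (m : nat) : Prop :=
  exists g : 'I_m -> H, (\sum_(i < m) (rho (g i) @: U))%VS = fullv.

(* The minimum has the junk value 0 when no finite sum of translates of U is
   the whole space; translates_coverP excludes this for irreducible rho and
   nonzero U. *)
Definition additive_diam (U : {vspace V}) : nat :=
  xget 0%N [set m | translates_cover U m /\
                    forall m', translates_cover U m' -> (m <= m')%N].

Definition covering_ratio (U : {vspace V}) : rat :=
  (additive_diam U)%:R
    / (Num.ceil ((\dim {:V})%:R / (\dim U)%:R : rat))%:~R.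

(* Junk value 0 when the maximum is not attained. *)
Definition covering_complexity : rat :=
  xget 0 [set c | (exists2 U : {vspace V}, U != 0%VS & covering_ratio U = c) /\
                  forall U : {vspace V}, U != 0%VS -> covering_ratio U <= c].

Lemma translates_cover_orbit (U : {vspace V}) :
  exists m (g : 'I_m -> H), forall h,
    (rho h @: U <= \sum_(i < m) (rho (g i) @: U))%VS.
Proof.
pose P := [pred d : nat | `[< exists m (g : 'I_m -> H),
  \dim (\sum_(i < m) (rho (g i) @: U))%VS = d >]].
have exP : exists d, P d.
  by eexists; apply/asboolP; exists 0%N; exists (fun _ => 1%g).
have ubP d : P d -> (d <= \dim {:V})%N.
  by move=> /asboolP[m [g <-]]; exact/dimvS/subvf.
case: (ex_maxnP exP ubP) => d /asboolP[m [g dimE]] dmax.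
exists m, g => h.
set S := (\sum_(i < m) _)%VS in dimE *.
pose g' (i : 'I_m.+1) := if unlift ord0 i is Some j then g j else h.
have S'E : (\sum_(i < m.+1) (rho (g' i) @: U))%VS = (rho h @: U + S)%VS.
  rewrite big_ord_recl /g' unlift_none; congr (_ + _)%VS.
  by apply: eq_bigr => i _; rewrite liftK.
have le_d : (\dim (rho h @: U + S)%VS <= d)%N.
  by apply: dmax; apply/asboolP; exists m.+1, g'; rewrite S'E.
have SE : S == (rho h @: U + S)%VS by rewrite eqEdim addvSr dimE.
by rewrite (eqP SE) addvSl.
Qed.

Lemma translates_coverP (U : {vspace V}) :
  irreducible_rep -> U != 0%VS -> translates_cover U (additive_diam U).
Proof.
move=> [_ irr] U0.
have [m [g Hg]] := translates_cover_orbit U.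
have cov : translates_cover U m.
  exists g; case: (irr (\sum_(i < m) (rho (g i) @: U))%VS) => [h||//].
    rewrite limg_sum; apply/subv_sumP => i _.
    by rewrite -limg_comp -linrepM; exact: Hg.
  move=> S0; have := Hg 1%g.
  by rewrite linrep1 lim1g S0 subv0 (negPf U0).
rewrite /additive_diam; case: xgetP => [_ _ [] //|none].
have exC : exists k, (fun k => `[< translates_cover U k >]) k.
  by exists m; exact/asboolP.
case: (ex_minnP exC) => k /asboolP covk kmin.
by case: (none k); split=> // k' /asboolP /kmin.
Qed.

End Representations.

Section SpecialLinear.

Variable F : fieldType.

Record SL2 := MkSL2 { sl2_mx :> 'M[F]_2; sl2_det : \det sl2_mx == 1 }.

HB.instance Definition _ := [isSub for sl2_mx].
HB.instance Definition _ := [Choice of SL2 by <:].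

Fact sl2_one_det : \det (1%:M : 'M[F]_2) == 1.
Proof. by rewrite det1. Qed.

Fact sl2_mul_det (g h : SL2) : \det (g *m h) == 1.
Proof. by rewrite det_mulmx (eqP (sl2_det g)) (eqP (sl2_det h)) mulr1. Qed.

Fact sl2_inv_det (g : SL2) : \det (invmx g) == 1.
Proof. by rewrite det_inv (eqP (sl2_det g)) invr1. Qed.

Definition sl2_one := MkSL2 sl2_one_det.
Definition sl2_mul (g h : SL2) := MkSL2 (sl2_mul_det g h).
Definition sl2_inv (g : SL2) := MkSL2 (sl2_inv_det g).

Lemma sl2_unitmx (g : SL2) : (g : 'M_2) \in unitmx.
Proof. by rewrite unitmxE (eqP (sl2_det g)) unitr1. Qed.

Fact sl2_mulA : associative sl2_mul.
Proof. by move=> g h k; apply: val_inj; rewrite /= mulmxA. Qed.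
Fact sl2_mul1g : left_id sl2_one sl2_mul.
Proof. by move=> g; apply: val_inj; rewrite /= mul1mx. Qed.
Fact sl2_mulg1 : right_id sl2_one sl2_mul.
Proof. by move=> g; apply: val_inj; rewrite /= mulmx1. Qed.
Fact sl2_mulVg : left_inverse sl2_one sl2_inv sl2_mul.
Proof. by move=> g; apply: val_inj; rewrite /= mulVmx ?sl2_unitmx. Qed.
Fact sl2_mulgV : right_inverse sl2_one sl2_inv sl2_mul.
Proof. by move=> g; apply: val_inj; rewrite /= mulmxV ?sl2_unitmx. Qed.

End SpecialLinear.

HB.instance Definition _ (F : fieldType) := isGroup.Build (SL2 F)
  (@sl2_mulA F) (@sl2_mul1g F) (@sl2_mulg1 F) (@sl2_mulVg F) (@sl2_mulgV F).

Section SymmetricPower.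

Variables (F : fieldType) (k : nat).

(* Sym^k F^2 is the degree-k part of the symmetric algebra F[X_0, X_1] of F^2,
   where X_0, X_1 is the standard basis of F^2.  The action of g is the algebra
   automorphism extending its action on F^2, X_j |-> \sum_i g i j X_i. *)
Definition sym_pow2 : vectType F := dhomog 2 F k.

Definition sl2_images (g : SL2 F) : 2.-tuple {mpoly F[2]} :=
  [tuple \sum_(i < 2) g i j *: 'X_i | j < 2].

Fact sl2_images_homog (g : SL2 F) (p : sym_pow2) :
  mpoly_of_dhomog p \mPo sl2_images g \is k.-homog.
Proof.
rewrite comp_mpolyE big_seq; apply: rpred_sum => m m_p.
apply/dhomogZ.
have <- : mdeg m = k by exact: dhomog_mf (dhomog_is_dhomog p) _ m_p.
rewrite mdegE.
apply: (big_ind2 (fun q d => q \is d.-homog)).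
- exact: dhomog1.
- by move=> q d r e; apply: dhomogM.
move=> j _; rewrite -[X in X.-homog]mul1n; apply: dhomogMn.
rewrite tnth_mktuple; apply: rpred_sum => i _.
by apply/dhomogZ; rewrite dhomogX /= mdeg1.
Qed.

Definition sl2_act (g : SL2 F) (p : sym_pow2) : sym_pow2 :=
  DHomog (sl2_images_homog g p).

Fact sl2_act_linear (g : SL2 F) : linear (sl2_act g).
Proof. by move=> a p q; apply: val_inj; rewrite /= linearP. Qed.

HB.instance Definition _ (g : SL2 F) :=
  GRing.isLinear.Build F sym_pow2 sym_pow2 _ (sl2_act g) (sl2_act_linear g).

Definition sym_pow2_fun (g : SL2 F) : 'End(sym_pow2) := linfun (sl2_act g).

Fact sym_pow2_fun1 : sym_pow2_fun 1%g = \1%VF.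
Proof.
apply/lfunP => p; rewrite lfunE id_lfunE; apply: val_inj => /=.
rewrite -[RHS]comp_mpoly_id; congr (_ \mPo _).
apply: eq_from_tnth => j; rewrite !tnth_mktuple (bigD1 j) //= big1 => [|i ne_ij].
  by rewrite mxE eqxx scale1r addr0.
by rewrite mxE (negPf ne_ij) scale0r.
Qed.

Fact sym_pow2_funM (g h : SL2 F) :
  sym_pow2_fun (g * h)%g = (sym_pow2_fun g \o sym_pow2_fun h)%VF.
Proof.
apply/lfunP => p; rewrite comp_lfunE !lfunE; apply: val_inj => /=.
rewrite [X in _ = X \mPo _]comp_mpolyE [LHS]comp_mpolyE linear_sum /=.
apply: eq_bigr => m _; rewrite comp_mpolyZ; congr (_ *: _).
rewrite rmorph_prod /=; apply: eq_bigr => j _; rewrite rmorphXn /=.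
congr (_ ^+ _); rewrite !tnth_mktuple linear_sum /=.
under [RHS]eq_bigr => i _.
  rewrite comp_mpolyZ comp_mpolyXU -tnth_nth tnth_mktuple scaler_sumr.
  under eq_bigr => l _ do rewrite scalerA.
  over.
rewrite exchange_big /=; apply: eq_bigr => l _.
rewrite mxE scaler_suml; apply: eq_bigr => i _.
by rewrite mulrC.
Qed.

Definition sym_pow2_rep : linrep (SL2 F) sym_pow2 :=
  LinRep sym_pow2_fun1 sym_pow2_funM.

End SymmetricPower.

(* Main.v *)
Require Import Defs.
From HB Require Import structures.
From mathcomp Require Import all_boot all_order all_algebra.
From mathcomp Require Import boolp classical_sets reals complex.
From mathcomp.multinomials Require Import mpoly.

(** Put n = k + 1 = dim V_k and view a binary form of degree k as a polynomial
    f of degree at most k, by setting X_1 = 1.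

    Transversality reduces to complementary dimensions: if dim W + dim U = n,
    then W meets some translate of U only at 0.  The general case follows by
    enlarging or shrinking W ([transversal_of_complementary]).

    In complementary dimensions, let b = dim U.  The idea is to let U and W
    degenerate to opposite members of the flag of coordinate subspaces.

    - Some translate of U contains no nonzero polynomial divisible by X^b.  The
      shears of SL_2 act by f(X) |-> f(X + t), so this says that for some t no
      nonzero f in U vanishes to order b at t ([generic_vanishing]).  It is
      classical that this holds for all but finitely many t, namely off the
      zeros of the Wronskian of a basis of U.  A basis with distinct degrees
      d_i is used, and the derivation X d/dX in place of d/dX: then the top
      coefficient of the Wronskian is, up to leading coefficients, the
      Vandermonde determinant of the d_i ([wronskian_neq0]), which is nonzero
      in characteristic 0.
    - Exchanging the variables, some translate of W contains no nonzero
      polynomial of degree less than b.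
    - Once U and W are replaced by these translates, U is the graph of a map C
      from the coefficients of index < b to those of index >= b, and W the graph
      of a map D in the other direction.  The torus element diag(s, 1/s)
      transforms C into a matrix C_s whose entries are multiples of positive
      powers of s, and a common vector of W and the translate of U gives a
      kernel vector of 1 - C_s D.  The determinant of that matrix is a
      polynomial in s with value 1 at s = 0, so it is nonzero for some s != 0
      ([torus_disjoint]).

    The other two claims hold for every transversal representation on a nonzero
    space.  A stable U satisfies dim U = max(0, 2 dim U - n), so U is 0 or
    everything.  Adding well-chosen translates of U one at a time gives
    dimension min(n, m dim U) after m steps, so exactly ceil(n / dim U)
    translates are needed and every ratio R(V, U) is 1. *)

Set Implicit Arguments.
Unset Strict Implicit.
Unset Printing Implicit Defensive.

Import Order.TTheory GRing.Theory Num.Theory.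

Local Open Scope ring_scope.

(** * Linear algebra and polynomials *)

(** The coordinates under L of a basis of U form an invertible matrix. *)
Lemma subspace_graph (F : fieldType) (V : vectType F) (b a : nat)
    (L : {linear V -> 'rV[F]_b}) (T : {linear V -> 'rV[F]_a}) (U : {vspace V}) :
  \dim U = b -> (forall f, f \in U -> L f = 0 -> f = 0) ->
  exists C : 'M[F]_(b, a), forall f, f \in U -> T f = L f *m C.
Proof.
move=> dimU; subst b => injL.
pose B := \matrix_(i < \dim U) L (vbasis U)`_i.
pose D := \matrix_(i < \dim U) T (vbasis U)`_i.
have coordE (n : nat) (S : {linear V -> 'rV[F]_n}) f : f \in U ->
    S f = (\row_i coord (vbasis U) i f) *m \matrix_(i < \dim U) S (vbasis U)`_i.
  move=> fU; rewrite {1}(coord_vbasis fU) linear_sum mulmx_sum_row.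
  by apply: eq_bigr => i _; rewrite linearZ /= rowK mxE.
have Bfree : row_free B.
  rewrite -kermx_eq0; apply/rowV0P => v /sub_kermxP vB0.
  pose f := \sum_(i < \dim U) v 0 i *: (vbasis U)`_i.
  have fU : f \in U.
    by apply: rpred_sum => i _; rewrite rpredZ // vbasis_mem // mem_nth // size_tuple.
  have vE : \row_i coord (vbasis U) i f = v.
    apply/rowP => i; rewrite mxE coord_sum_free //.
    exact: basis_free (vbasisP U).
  have f0 : f = 0 by apply: injL => //; rewrite coordE // vE.
  by rewrite -vE f0; apply/rowP => i; rewrite !mxE linear0.
exists (invmx B *m D) => f fU.
by rewrite (coordE _ L) // (coordE _ T) // mulmxA mulmxK // -row_free_unit.
Qed.

Lemma natr_inj_pchar0 (F : fieldType) :
  [pchar F] =i pred0 -> injective (fun n => n%:R : F).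
Proof.
move=> /pcharf0P char0.
suff le_inj m n : (m <= n)%N -> m%:R = n%:R :> F -> m = n.
  move=> m n eq_mn; case/orP: (leq_total m n) => le_mn; first exact: le_inj.
  by apply/esym/le_inj.
move=> le_mn /eqP; rewrite eq_sym -subr_eq0 -natrB // char0 subn_eq0.
by move=> le_nm; apply/eqP; rewrite eqn_leq le_mn.
Qed.

Lemma poly_nonroot (F : fieldType) (p : {poly F}) :
  [pchar F] =i pred0 -> p != 0 -> exists2 t : F, t != 0 & ~~ root p t.
Proof.
move=> char0 p0.
pose s : seq F := [seq n.+1%:R | n <- iota 0 (size p)].
have inj_nat : injective (fun n => n.+1%:R : F).
  by move=> m n /(natr_inj_pchar0 char0) [].
have : ~~ all (root p) s.
  apply/negP => rs; have := max_poly_roots p0 rs.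
  by rewrite map_inj_uniq ?iota_uniq // size_map size_iota ltnn => /(_ isT).
case/allPn => _ /mapP[n _ ->] nroot; exists n.+1%:R => //.
by move/pcharf0P: char0 => ->.
Qed.

Lemma coef_prod_top (R : comNzRingType) (I : finType) (p : I -> {poly R})
    (d : I -> nat) : (forall i, (size (p i) <= (d i).+1)%N) ->
  (\prod_i p i)`_(\sum_i d i)%N = \prod_i (p i)`_(d i).
Proof.
move=> szp.
pose top (q : {poly R}) (e : nat) (x : R) := (size q <= e.+1)%N /\ q`_e = x.
suff [] : top (\prod_i p i) (\sum_i d i)%N (\prod_i (p i)`_(d i)) by [].
apply: (big_ind3 top) => [||i _] //; rewrite /top.
- by rewrite size_poly1 coef1.
- move=> q e x r e' y [szq qe] [szr re']; split.
  apply: leq_trans (size_polyMleq _ _) _.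
  rewrite (@leq_trans (e.+1 + e'.+1).-1) //; last by rewrite addnS.
  by rewrite -!subn1 leq_sub2r // leq_add.
rewrite coefM (bigD1 (inord e)) //= inordK ?ltnS ?leq_addr // addKn qe re'.
rewrite big1 ?addr0 // => i; rewrite -val_eqE /= inordK ?ltnS ?leq_addr // => ne_ie.
case: (ltngtP i e) ne_ie => // [lt_ie|lt_ei] _.
  by rewrite [r`__]nth_default ?mulr0 // (leq_trans szr) // ltn_subRL ltn_add2r.
by rewrite nth_default ?mul0r // (leq_trans szq).
Qed.

(** When the degrees of row i are bounded by d_i, the coefficient of degree
    sum d_i of every term of the Leibniz expansion is a product of coefficients
    of degree d_i, so extracting top coefficients commutes with det. *)
Lemma coef_det_top (R : comNzRingType) (m : nat) (A : 'M[{poly R}]_m)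
    (d : 'I_m -> nat) : (forall i j, (size (A i j) <= (d i).+1)%N) ->
  (\det A)`_(\sum_i d i)%N = \det (\matrix_(i, j) (A i j)`_(d i)).
Proof.
move=> szA; rewrite /determinant coef_sum; apply: eq_bigr => s _.
rewrite !mulr_sign.
have prodE : (\prod_i A i (perm.fun_of_perm s i))`_(\sum_i d i)%N =
    \prod_i (\matrix_(i, j) (A i j)`_(d i)) i (perm.fun_of_perm s i).
  by rewrite coef_prod_top //; apply: eq_bigr => i _; rewrite mxE.
by case: (perm.odd_perm s); rewrite ?coefN prodE.
Qed.

(** * Wronskians and orders of vanishing *)

Section Wronskian.

Variable F : fieldType.

(** Unlike the derivative, this derivation X d/dX preserves degrees and has the
    powers of X as eigenvectors; its iterates turn a Wronskian matrix into one
    whose top coefficients form a Vandermonde matrix. *)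
Definition euler (p : {poly F}) : {poly F} := 'X * p^`().

Fact euler_linear : linear euler.
Proof. by move=> a p q; rewrite /euler linearP /= mulrDr scalerAr. Qed.

HB.instance Definition _ :=
  GRing.isLinear.Build F {poly F} {poly F} _ euler euler_linear.

Lemma iter_euler_linear j : linear (iter j euler).
Proof. by elim: j => // j IHj a p q /=; rewrite (IHj a p q) linearP. Qed.

Lemma coef_iter_euler j p i : (iter j euler p)`_i = i%:R ^+ j * p`_i.
Proof.
elim: j i => [|j IHj] i; first by rewrite mul1r.
rewrite /= /euler coefXM; case: i => [|i] /=; first by rewrite expr0n mul0r.
by rewrite coef_deriv IHj exprS -mulrA mulr_natl.
Qed.

Lemma euler_vanish t m p : ('X - t%:P) ^+ m.+1 %| p -> ('X - t%:P) ^+ m %| euler p.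
Proof.
move=> /dvdpP[q ->]; rewrite /euler; apply: dvdp_mull.
rewrite derivM deriv_exp derivXsubC mul1r /=; apply: dvdp_add.
  by rewrite exprS mulrA dvdp_mulIr.
by rewrite dvdp_mull // -mulr_natr dvdp_mulIl.
Qed.

Lemma iter_euler_root t m j p : ('X - t%:P) ^+ m %| p -> (j < m)%N ->
  (iter j euler p).[t] = 0.
Proof.
move=> dvd_p lt_jm; apply/eqP; rewrite -/(root _ t) -dvdp_XsubCl.
have : ('X - t%:P) ^+ (m - j) %| iter j euler p.
  elim: j lt_jm => [|j IHj] lt_jm; first by rewrite subn0.
  by apply: euler_vanish; rewrite -subSn ?subSS ?IHj // ltnW.
by apply: dvdp_trans; rewrite -(subnSK lt_jm) exprS dvdp_mulIl.
Qed.

(** The coefficient of degree sum deg p_i is the product of the leading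
    coefficients times the Vandermonde determinant of the degrees, which are
    distinct in F because F has characteristic 0. *)
Lemma wronskian_neq0 (m : nat) (p : 'I_m -> {poly F}) :
  [pchar F] =i pred0 -> (forall i, p i != 0) ->
  injective (fun i => size (p i)) ->
  \det (\matrix_(i, j) iter j euler (p i)) != 0.
Proof.
move=> char0 p0 inj_size.
pose d i := (size (p i)).-1.
have szp i : size (p i) = (d i).+1 by rewrite prednK // size_poly_gt0.
have inj_nat i j : (d i)%:R = (d j)%:R :> F -> i = j.
  move/(natr_inj_pchar0 char0) => eq_d.
  by apply: inj_size; rewrite !szp eq_d.
suff W0 : (\det (\matrix_(i, j) iter j euler (p i)))`_(\sum_i d i)%N != 0.
  by apply: contraNneq W0 => ->; rewrite coef0.
rewrite coef_det_top => [|i j]; last first.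
  rewrite mxE; apply/leq_sizeP => l le_l.
  by rewrite coef_iter_euler nth_default ?mulr0 // szp.
have -> : \matrix_(i, j) ((\matrix_(i, j < m) iter j euler (p i)) i j)`_(d i) =
    diag_mx (\row_i lead_coef (p i)) *m (Vandermonde m (\row_i (d i)%:R))^T.
  apply/matrixP => i j; rewrite mul_diag_mx !mxE coef_iter_euler mulrC.
  by rewrite lead_coefE.
rewrite det_mulmx det_diag det_tr det_Vandermonde mulf_neq0 //.
  by apply/prodf_neq0 => i _; rewrite mxE lead_coef_eq0.
apply/prodf_neq0 => i _; apply/prodf_neq0 => j lt_ij; rewrite !mxE subr_eq0.
by apply: contraTneq lt_ij => /inj_nat ->; rewrite ltnn.
Qed.

End Wronskian.

(** Let S be the set of degrees of the nonzero elements of phi(U).  Coefficients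
    in the degrees of S separate U, so dim U <= #|S|.  Conversely elements of U
    realizing all of S have a nonzero Wronskian; at a t where it does not vanish,
    the #|S| values (X d/dX)^j f (t) map U onto F^S.  Hence dim U = #|S| and
    these values determine f; they are all 0 if f vanishes to order dim U. *)
Lemma generic_vanishing (F : fieldType) (V : vectType F)
    (phi : {linear V -> {poly F}}) (U : {vspace V}) :
  [pchar F] =i pred0 -> injective phi ->
  exists t : F, forall f, f \in U -> ('X - t%:P) ^+ \dim U %| phi f -> f = 0.
Proof.
move=> char0 inj_phi.
pose N := \max_(i < \dim {:V}) size (phi (vbasis {:V})`_i)%R.
have szN f : (size (phi f) <= N)%N.
  rewrite {1}(coord_vbasis (memvf f)) linear_sum /=.
  apply: leq_trans (size_sum _ _ _) _; apply/bigmax_leqP => i _.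
  rewrite linearZ /=; apply: leq_trans (size_scale_leq _ _) _.
  exact: (@leq_bigmax _ (fun j : 'I_(\dim {:V}) => size (phi (vbasis {:V})`_j)%R) i).
pose S := [set d : 'I_N | `[< exists2 f, f \in U & size (phi f) = d.+1 >]].
pose d (i : 'I_#|S|) : 'I_N := enum_val i.
have wit i : exists f, (f \in U) && (size (phi f) == (d i).+1).
  have := enum_valP i; rewrite inE => /asboolP[f fU szf].
  by exists f; rewrite fU szf eqxx.
pose f i := xchoose (wit i).
have fU i : f i \in U by case/andP: (xchooseP (wit i)).
have szf i : size (phi (f i)) = (d i).+1 by apply/eqP; case/andP: (xchooseP (wit i)).
have [|t _ nroot] := @poly_nonroot F
   (\det (\matrix_(i, j) iter j (@euler F) (phi (f i)))) char0.
  apply: wronskian_neq0 => // [i|i j].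
    by rewrite -size_poly_gt0 szf.
  by rewrite !szf => -[] /val_inj/enum_val_inj.
have le_dim : (\dim U <= #|S|)%N.
  have lin : linear (fun g => \row_(i < #|S|) (phi g)`_(d i)).
    by move=> a g h; apply/rowP => i; rewrite !mxE linearP coefD coefZ.
  pose E : {linear V -> 'rV[F]_#|S|} :=
    HB.pack (fun g => \row_(i < #|S|) (phi g)`_(d i))
      (GRing.isLinear.Build F V 'rV[F]_#|S| _ _ lin).
  rewrite -(@limg_dim_eq _ _ _ (linfun E)).
    by apply: leq_trans (dimvS (subvf _)) _; rewrite dimvf /dim /= mul1n.
  apply/eqP; rewrite -subv0; apply/subvP => g; rewrite memv_cap memv_ker memv0.
  case/andP => gU; rewrite lfunE /= => /eqP/rowP g0; apply/negPn/negP => gn0.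
  have phig0 : phi g != 0.
    by apply: contraNneq gn0 => phig0; rewrite -(inj_eq inj_phi) phig0 linear0.
  (* the leading coefficient of phi g is one of the coefficients in S *)
  have szg : size (phi g) = (size (phi g)).-1.+1 by rewrite prednK // size_poly_gt0.
  have lt_N : ((size (phi g)).-1 < N)%N by rewrite -szg.
  have gS : Ordinal lt_N \in S by rewrite inE; apply/asboolP; exists g.
  have := g0 (enum_rank_in gS (Ordinal lt_N)).
  rewrite !mxE /d enum_rankK_in //= => /eqP.
  by rewrite -lead_coefE lead_coef_eq0 (negPf phig0).
exists t => g gU dvd_g.
have lin : linear (fun g => \row_(j < #|S|) (iter j (@euler F) (phi g)).[t]).
  by move=> a h h'; apply/rowP => i; rewrite !mxE linearP iter_euler_linear !hornerE.
pose T : {linear V -> 'rV[F]_#|S|} :=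
  HB.pack (fun g => \row_(j < #|S|) (iter j (@euler F) (phi g)).[t])
    (GRing.isLinear.Build F V 'rV[F]_#|S| _ _ lin).
pose A := \matrix_(i < #|S|) T (f i).
have unitA : A \in unitmx.
  have AE : A = map_mx (horner_eval t) (\matrix_(i, j) iter j (@euler F) (phi (f i))).
    by apply/matrixP => i j; rewrite !mxE.
  by rewrite unitmxE AE det_map_mx unitfE.
have fullT : (linfun T @: U)%VS = fullv.
  apply/eqP; rewrite eqEsubv subvf /=; apply/subvP => v _.
  rewrite -(mulmxKV unitA v) mulmx_sum_row; apply: rpred_sum => i _.
  by rewrite rpredZ // rowK -[T _]lfunE memv_img.
have := limg_ker_dim (linfun T) U; rewrite fullT dimvf /dim /= mul1n => dimE.
have dimU : \dim U = #|S|.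
  by apply/eqP; rewrite eqn_leq le_dim -dimE leq_addl.
have ker0 : (U :&: lker (linfun T) = 0)%VS.
  by apply/eqP; rewrite -dimv_eq0 -(eqn_add2r #|S|) dimE dimU.
apply/eqP; rewrite -memv0 -ker0 memv_cap gU memv_ker lfunE /=.
apply/eqP/rowP => j; rewrite !mxE.
by apply: iter_euler_root dvd_g _; rewrite dimU.
Qed.

(** * Binary forms as polynomials in one variable *)

Fact lift01 : lift ord0 ord0 = 1 :> 'I_2.
Proof. exact: val_inj. Qed.

Section BinaryForms.

Variables (F : fieldType) (k : nat).

Definition dehom (p : sym_pow2 F k) : {poly F} :=
  mmap (@polyC F) (fun i => if i == 0 then 'X else 1) (mpoly_of_dhomog p).

Fact dehom_linear : linear dehom.
Proof. by move=> a p q; rewrite /dehom linearP /= mmapD mmapZ mul_polyC. Qed.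

HB.instance Definition _ :=
  GRing.isLinear.Build F (sym_pow2 F k) {poly F} _ dehom dehom_linear.

(** A form is determined by its dehomogenization: this expansion in an arbitrary
    commutative ring yields both injectivity (take the polynomial ring in two
    variables) and the formula for the action of SL_2. *)
Lemma mmap_form (S : comNzRingType) (f : {rmorphism F -> S}) (h : 'I_2 -> S)
    (p : sym_pow2 F k) :
  mmap f h (mpoly_of_dhomog p) =
    \sum_(i < k.+1) f (dehom p)`_i * (h 0 ^+ i * h 1 ^+ (k - i)).
Proof.
have supp m : m \in msupp (mpoly_of_dhomog p) -> (m 0%R + m 1%R)%N = k.
  move=> /(dhomog_mf (dhomog_is_dhomog p)) /= <-.
  by rewrite mdegE big_ord_recl big_ord1 lift01.
have coefE i : (dehom p)`_i =
    \sum_(m <- msupp (mpoly_of_dhomog p)) (mpoly_of_dhomog p)@_m * (m 0%R == i)%:R.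
  rewrite /dehom /mmap coef_sum; apply: eq_bigr => m _.
  rewrite /mmap1 big_ord_recl big_ord1 /= expr1n mulr1 coefCM coefXn.
  by rewrite eq_sym.
under eq_bigr do rewrite coefE rmorph_sum mulr_suml.
rewrite exchange_big /= /mmap !big_seq; apply: eq_bigr => m /supp mk.
have lt_m : (m 0%R < k.+1)%N by rewrite ltnS -mk leq_addr.
rewrite (bigD1 (Ordinal lt_m)) //= eqxx mulr1 big1 ?addr0 => [|i ne_i]; last first.
  rewrite [_ == _](negPf _) ?mulr0 ?rmorph0 ?mul0r //.
  by apply: contraNneq ne_i => eq_i; apply/eqP/val_inj.
by rewrite /mmap1 big_ord_recl big_ord1 lift01 /= -[in (k - _)%N]mk addKn.
Qed.

Lemma dehom_inj : injective dehom.
Proof.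
apply: raddf_inj => p p0; apply/val_inj => /=.
rewrite -[LHS]comp_mpoly_id /comp_mpoly mmap_form p0.
by rewrite big1 // => i _; rewrite coef0 rmorph0 mul0r.
Qed.

Lemma size_dehom p : (size (dehom p) <= k.+1)%N.
Proof.
rewrite {1}/dehom mmap_form; apply: leq_trans (size_sum _ _ _) _.
apply/bigmax_leqP => i _; rewrite expr1n mulr1 mul_polyC.
by apply: leq_trans (size_scale_leq _ _) _; rewrite size_polyXn.
Qed.

Lemma dim_sym_pow2 : \dim {:sym_pow2 F k} = k.+1.
Proof. by rewrite dimvf /dim /= addn1 binSn. Qed.

Lemma dehom_act g p : dehom (sl2_act g p) =
  \sum_(i < k.+1) (dehom p)`_i *:
    ((g 0 0 *: 'X + (g 1 0)%:P) ^+ i * (g 0 1 *: 'X + (g 1 1)%:P) ^+ (k - i)).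
Proof.
rewrite {1}/dehom /= /comp_mpoly mmap_form raddf_sum /=; apply: eq_bigr => i _.
have imgE j : mmap (@polyC F) (fun i => if i == 0 then 'X else 1)
    (tnth (sl2_images g) j) = g 0 j *: 'X + (g 1 j)%:P.
  rewrite tnth_mktuple raddf_sum /= big_ord_recl big_ord1 !mmapZ !mmapX !mmap1U /=.
  by rewrite mulr1 mul_polyC; congr (g _ _ *: _ + (g _ _)%:P); apply/val_inj.
by rewrite mul_mpolyC mmapZ mul_polyC rmorphM !rmorphXn /= !imgE.
Qed.

Definition mx2 (a b c d : F) : 'M[F]_2 :=
  \matrix_(i, j) if i == 0 then (if j == 0 then a else b)
                 else (if j == 0 then c else d).

Lemma det_mx2 a b c d : \det (mx2 a b c d) = a * d - b * c.
Proof.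
rewrite (expand_det_row _ 0) big_ord_recl big_ord1 /cofactor !det_mx11 !mxE /=.
by rewrite expr0 mul1r expr1 mulN1r mulrN.
Qed.

Fact shear_det t : \det (mx2 1 0 t 1) == 1.
Proof. by rewrite det_mx2 mul0r subr0 mulr1. Qed.
Definition shear t := MkSL2 (shear_det t).

Fact swap_det : \det (mx2 0 (-1) 1 0) == 1.
Proof. by rewrite det_mx2 mul0r mulN1r opprK add0r. Qed.
Definition swap := MkSL2 swap_det.

(** At s = 0 the identity is a default value. *)
Fact torus_det (s : F) : \det (if s == 0 then 1%:M else mx2 s 0 0 s^-1) == 1.
Proof.
by case: (eqVneq s 0) => [_|s0]; rewrite ?det1 // det_mx2 mul0r subr0 divff.
Qed.
Definition torus s := MkSL2 (torus_det s).

Lemma dehom_shear t p :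
  dehom (sl2_act (shear t) p) = dehom p \Po ('X + t%:P).
Proof.
rewrite dehom_act !mxE /= comp_polyE.
rewrite [RHS](big_ord_widen k.+1 (fun i => (dehom p)`_i *: ('X + t%:P) ^+ i));
  last exact: size_dehom.
rewrite [RHS]big_mkcond /=; apply: eq_bigr => i _.
rewrite scale1r scale0r add0r expr1n mulr1.
by case: ltnP => // le_i; rewrite nth_default ?scale0r.
Qed.

Lemma dehom_swap p i : (i <= k)%N ->
  (dehom (sl2_act swap p))`_i = (-1) ^+ i * (dehom p)`_(k - i).
Proof.
move=> le_ik; rewrite dehom_act !mxE /= coef_sum.
have termE (j : 'I_k.+1) : ((dehom p)`_j *: ((0 *: 'X + 1%:P) ^+ j *
    (-1 *: 'X + 0%:P) ^+ (k - j)))`_i =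
    (dehom p)`_j * ((-1) ^+ (k - j) * (i == k - j)%N%:R).
  rewrite polyC1 polyC0 scale0r add0r addr0 expr1n mul1r exprZn.
  by rewrite !coefZ coefXn.
rewrite (eq_bigr _ (fun j _ => termE j)) (bigD1 (inord (k - i))) //=.
rewrite inordK ?ltnS ?leq_subr // subKn // eqxx mulr1 mulrC big1 ?addr0 // => j.
rewrite -val_eqE /= inordK ?ltnS ?leq_subr // => ne_j.
rewrite (_ : (i == k - j)%N = false) ?mulr0 //.
by apply: contraNF ne_j => /eqP ->; rewrite subKn // -ltnS.
Qed.

(** Multiplying by s ^+ k avoids the negative exponent in s ^ (2 i - k). *)
Lemma dehom_torus s p i : s != 0 -> (i <= k)%N ->
  s ^+ k * (dehom (sl2_act (torus s) p))`_i = s ^+ (2 * i) * (dehom p)`_i.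
Proof.
move=> s0 le_ik; rewrite dehom_act /= (negPf s0) !mxE /= coef_sum.
have termE (j : 'I_k.+1) : ((dehom p)`_j *: ((s *: 'X + 0%:P) ^+ j *
    (0 *: 'X + s^-1%:P) ^+ (k - j)))`_i =
    (dehom p)`_j * (s ^+ j * s^-1 ^+ (k - j) * (i == j)%:R).
  rewrite polyC0 addr0 scale0r add0r exprZn -scalerAl -polyC_exp.
  rewrite coefZ coefZ coefMC coefXn.
  by rewrite -mulrA [_%:R * _]mulrC.
rewrite (eq_bigr _ (fun j _ => termE j)) (bigD1 (inord i)) //= inordK // big1 ?addr0.
  rewrite eqxx mulr1 mulrCA mulrC; congr (_ * _); rewrite exprVn mulrA -exprD.
  apply: (mulIf (expf_neq0 (k - i) s0)); rewrite divfK ?expf_neq0 // -exprD.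
  by rewrite mul2n -addnn -addnA subnKC // addnC.
move=> j; rewrite -val_eqE /= inordK // eq_sym => /negPf ->.
by rewrite !mulr0.
Qed.

End BinaryForms.

(** * Transversal representations *)

Section TransversalRepresentations.

Variables (F : fieldType) (H : groupType) (V : vectType F) (rho : linrep H V).

Lemma subv_dim_between (A B : {vspace V}) d :
  (A <= B)%VS -> (\dim A <= d <= \dim B)%N ->
  exists2 C : {vspace V}, (A <= C <= B)%VS & \dim C = d.
Proof.
move=> sAB /andP[le_Ad]; rewrite -(subnKC le_Ad); move: (d - _)%N => e {d le_Ad}.
elim: e => [|e IHe] le_B; first by exists A; rewrite ?subvv ?addn0.
have [|C /andP[sAC sCB] dimC] := IHe; first by rewrite ltnW // -addnS.
have /subvPn[v vB vC] : ~~ (B <= C)%VS.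
  by apply: contraL le_B => /dimvS; rewrite dimC addnS -ltnNge ltnS.
exists (C + <[v]>)%VS.
  by rewrite (subv_trans sAC (addvSl _ _)) subv_add sCB -memvE.
rewrite dimv_disjoint_sum ?dimC ?dim_vline.
  by rewrite (_ : v != 0) ?addn1 ?addnS //; apply: contraNneq vC => ->; exact: mem0v.
apply/eqP; rewrite -subv0; apply/subvP => u; rewrite memv_cap memv0.
case/andP => uC /vlineP[c uE]; move: uC; rewrite uE.
have [->|c0] := eqVneq c 0; first by rewrite scale0r.
by rewrite rpredZeq (negPf c0) (negPf vC).
Qed.

Lemma rep_lker0 g : lker (rho g) == 0%VS.
Proof.
apply/lker0P; apply: (can_inj (g := rho g^-1%g)) => v.
by rewrite -comp_lfunE -linrepM mulVg linrep1 id_lfunE.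
Qed.

Lemma dim_rep g (U : {vspace V}) : \dim (rho g @: U) = \dim U.
Proof. by rewrite limg_dim_eq // (eqP (rep_lker0 g)) capv0. Qed.

(** If dim W + dim U is too small, enlarge W to W' of dimension n - dim U, and
    W meets gU trivially because W' does; if it is too large, shrink W to such a
    W', and then W + gU is the whole space because W' + gU is. *)
Lemma transversal_of_complementary :
  (forall W U : {vspace V}, (\dim W + \dim U)%N = \dim {:V} ->
    exists g, (W :&: rho g @: U = 0)%VS) -> transversal_rep rho.
Proof.
move=> compl W U.
have leU : (\dim U <= \dim {:V})%N by exact/dimvS/subvf.
have dimcU : (\dim {:V} - \dim U + \dim U)%N = \dim {:V} by rewrite subnK.
have [le_n|/ltnW le_n] := leqP (\dim W + \dim U) (\dim {:V}).
  have [|W' /andP[sWW' _] dimW'] :=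
      @subv_dim_between W fullv (\dim {:V} - \dim U)%N (subvf _).
    by rewrite leq_subr andbT -(leq_add2r (\dim U)) dimcU.
  have [|g disj] := compl W' U; first by rewrite dimW'.
  exists g; move: le_n; rewrite -subn_eq0 => /eqP ->; apply/eqP.
  by rewrite dimv_eq0 -subv0 -disj capvS.
have [|W' /andP[_ sW'W] dimW'] :=
    @subv_dim_between 0%VS W (\dim {:V} - \dim U)%N (sub0v _).
  by rewrite dimv0 leq_subLR addnC.
have [|g disj] := compl W' U; first by rewrite dimW'.
exists g; have sum_full : (W + rho g @: U = fullv)%VS.
  apply/eqP; rewrite eqEdim subvf /= -dimcU -{1}dimW' -(dim_rep g U).
  by rewrite -dimv_disjoint_sum // dimvS // addvS.
by rewrite -(dim_rep g U) -dimv_sum_cap sum_full addKn.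
Qed.

Hypothesis transv : transversal_rep rho.

Lemma transversal_sum_dim (W U : {vspace V}) :
  exists g, \dim (W + rho g @: U) = minn (\dim W + \dim U) (\dim {:V}).
Proof.
have [g dim_cap] := transv W U; exists g.
by rewrite minnE -dim_cap -(dim_rep g U) -dimv_sum_cap addnK.
Qed.

Lemma transversal_irreducible :
  fullv != 0%VS :> {vspace V} -> irreducible_rep rho.
Proof.
move=> V0; split=> // U stableU; have [g] := transv U U.
rewrite (capv_idPr (stableU g)) dim_rep => dimU.
have leU : (\dim U <= \dim {:V})%N by exact/dimvS/subvf.
have [U0|U0] := eqVneq (\dim U) 0%N.
  by left; apply/eqP; rewrite -dimv_eq0 U0.
right; apply/eqP; rewrite eqEdim subvf /= leqNgt; apply: contraNN U0 => lt_U.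
rewrite -leqn0 leqNgt; apply/negP => U_gt0.
by have := ltnn (\dim U); rewrite {1}dimU ltn_psubLR // ltn_add2r lt_U.
Qed.

Lemma transversal_translates (U : {vspace V}) m :
  exists g : 'I_m -> H,
    \dim (\sum_(i < m) (rho (g i) @: U))%VS = minn (m * \dim U) (\dim {:V}).
Proof.
elim: m => [|m [g dimS]].
  by exists (fun=> 1%g); rewrite big_ord0 dimv0 mul0n min0n.
have [h dimSh] := transversal_sum_dim (\sum_(i < m) (rho (g i) @: U))%VS U.
(* unlift ord_max recognizes the last index, where the new translate is put *)
exists (fun i => if unlift ord_max i is Some j then g j else h).
rewrite big_ord_recr /= unlift_none; under eq_bigr => i _.
  rewrite (_ : widen_ord _ i = lift ord_max i) ?liftK; last exact/val_inj/esym/lift_max.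
  over.
rewrite dimSh dimS addn_minl mulSnr -minnA; congr minn.
by apply/minn_idPr; rewrite leq_addr.
Qed.

Lemma transversal_coverP (U : {vspace V}) m :
  translates_cover rho U m <-> (\dim {:V} <= m * \dim U)%N.
Proof.
split=> [[g sum_full]|le_V].
  rewrite -sum_full.  apply: leq_trans (dimv_leq_sum _ _ _) _.
  by rewrite (eq_bigr (fun=> \dim U)) ?sum_nat_const ?card_ord // => i _; rewrite dim_rep.
have [g dimS] := transversal_translates U m; exists g.
by apply/eqP; rewrite eqEdim subvf /= dimS (minn_idPr le_V).
Qed.

Lemma transversal_covering_ratio (U : {vspace V}) :
  fullv != 0%VS :> {vspace V} -> U != 0%VS -> covering_ratio rho U = 1.
Proof.
rewrite -!dimv_eq0 -!lt0n => V0 U0.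
have U0q : 0 < (\dim U)%:R :> rat by rewrite ltr0n.
have cover_ceil m : translates_cover rho U m <->
    Num.ceil ((\dim {:V})%:R / (\dim U)%:R : rat) <= m%:Z.
  by rewrite transversal_coverP ceil_le_int ler_pdivrMr // -natrM ler_nat.
have ceil_gt0 : 0 < Num.ceil ((\dim {:V})%:R / (\dim U)%:R : rat).
  by rewrite ceil_gt0 divr_gt0 ?ltr0n.
rewrite /covering_ratio; move: (Num.ceil _) cover_ceil ceil_gt0.
case=> // c cover_c c_gt0.
have -> : additive_diam rho U = c.
  rewrite /additive_diam; case: xgetP => [d _ [cov_d min_d]|none].
    by apply/eqP; rewrite eqn_leq min_d -?lez_nat; apply/cover_c.
  case: (none c); split; first exact/cover_c.
  by move=> d /cover_c.
by rewrite divff // pnatr_eq0 -lt0n.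
Qed.

Lemma transversal_covering_complexity :
  fullv != 0%VS :> {vspace V} -> covering_complexity rho = 1.
Proof.
move=> V0; rewrite /covering_complexity; case: xgetP => [c _ [[U U0 <-] _]|none].
  exact: transversal_covering_ratio.
case: (none 1); split; first by exists fullv => //; exact: transversal_covering_ratio.
by move=> U U0; rewrite transversal_covering_ratio.
Qed.

End TransversalRepresentations.

(** * Transversality of the symmetric powers *)

Section GeneralPosition.

Variables (F : fieldType) (k : nat).
Hypothesis char0 : [pchar F] =i pred0.

Notation V := (sym_pow2 F k).
Notation rho := (sym_pow2_rep F k).

(** The coordinate projections along the flag of coordinate subspaces: the
    kernel with m = 0 consists of the polynomials divisible by X^n, and the
    kernel with m + n = k + 1 of those of degree less than m. *)
Definition coef_window n m (p : V) : 'rV[F]_n := \row_(i < n) (dehom p)`_(m + i).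

Fact coef_window_linear n m : linear (@coef_window n m).
Proof. by move=> a p q; apply/rowP => i; rewrite !mxE linearP coefD coefZ. Qed.

HB.instance Definition _ n m :=
  GRing.isLinear.Build F V 'rV[F]_n _ (@coef_window n m) (@coef_window_linear n m).

Lemma rhoE g p : rho g p = sl2_act g p.
Proof. by rewrite lfunE. Qed.

(** Translating a polynomial by t moves vanishing at t to vanishing at 0. *)
Lemma low_general_position (U : {vspace V}) :
  exists g, forall p, p \in (rho g @: U)%VS -> coef_window (\dim U) 0 p = 0 -> p = 0.
Proof.
have [t vanish] := generic_vanishing U char0 (@dehom_inj F k).
exists (shear t) => _ /memv_imgP[p pU ->]; rewrite rhoE => /rowP low0.
rewrite (vanish p) ?linear0 //=.
set b := \dim U in low0 *; pose q := drop_poly b (dehom (sl2_act (shear t) p)).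
have qE : dehom p \Po ('X + t%:P) = q * 'X^b.
  rewrite -dehom_shear -[LHS](poly_take_drop b) [take_poly _ _](_ : _ = 0) ?add0r //.
  apply/polyP => i; rewrite coef_take_poly coef0; case: ltnP => // lt_ib.
  by have := low0 (Ordinal lt_ib); rewrite !mxE.
have -> : dehom p = (dehom p \Po ('X + t%:P)) \Po ('X - t%:P).
  by rewrite -comp_polyA comp_polyD comp_polyX comp_polyC subrK comp_polyXr.
by rewrite qE comp_polyM rmorphXn /= comp_polyX dvdp_mulIr.
Qed.

(** The swap of the two variables reverses the list of coefficients. *)
Lemma high_general_position (W : {vspace V}) c : (c + \dim W)%N = k.+1 ->
  exists g, forall p, p \in (rho g @: W)%VS -> coef_window (\dim W) c p = 0 -> p = 0.
Proof.
move=> dimW; have [g low] := low_general_position W.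
exists (swap F * g)%g => p.
rewrite linrepM limg_comp => /memv_imgP[q qW ->]; rewrite rhoE => /rowP high0.
rewrite (low q qW) -?rhoE ?linear0 //; apply/rowP => i; rewrite !mxE add0n.
have lt_i : (i < k.+1)%N by rewrite -dimW ltn_addl.
have := high0 (rev_ord i); rewrite !mxE dehom_swap; last first.
  by rewrite -ltnS -dimW ltn_add2l.
move/eqP; rewrite mulf_eq0 signr_eq0 /= => /eqP; congr (_`__ = 0).
by rewrite -subSS -dimW -addnS subnDl subnSK // subKn // ltnW.
Qed.

(** U and W are graphs of C and D in opposite directions, and the torus rescales
    the (i, j) entry of C, which maps the coefficient of index i < b to that of
    index b + j, by s ^+ (2 * (b + j - i)).  The exponent is positive, so the
    rescaled graph tends to the span of 1, X, ..., X^(b - 1) as s tends to 0,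
    and this limit is disjoint from W.  The determinant of M detects
    disjointness, and its value at s = 0 is 1. *)
Lemma torus_disjoint (a b : nat) (U W : {vspace V}) : (b + a)%N = k.+1 ->
  \dim U = b -> \dim W = a ->
  (forall p, p \in U -> coef_window b 0 p = 0 -> p = 0) ->
  (forall p, p \in W -> coef_window a b p = 0 -> p = 0) ->
  exists g, (W :&: rho g @: U = 0)%VS.
Proof.
move=> ab dimU dimW lowU highW.
have [C highC] := subspace_graph (coef_window a b) dimU lowU.
have [D lowD] := subspace_graph (coef_window b 0) dimW highW.
pose CX := \matrix_(i, j) (C i j *: 'X^(2 * (b + j - i))) : 'M[{poly F}]_(b, a).
pose M := 1%:M - CX *m map_mx polyC D.
have hornM s : map_mx (horner_eval s) M = 1%:M - map_mx (horner_eval s) CX *m D.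
  rewrite map_mxB map_mx1 map_mxM; congr (_ - _ *m _).
  by apply/matrixP => i j; rewrite !mxE /= /horner_eval hornerC.
have [|s s0 nroot] := @poly_nonroot F (\det M) char0.
  apply: contraTneq (oner_neq0 F) => M0; rewrite negbK.
  rewrite -(det1 F b) -[X in _ == X](horner0 0) -M0.
  rewrite -[_.[0]]/(horner_eval 0 _) -det_map_mx hornM.
  rewrite (_ : map_mx _ CX = 0) ?mul0mx ?subr0 //.
  apply/matrixP => i j; rewrite !mxE /= /horner_eval hornerZ hornerXn.
  rewrite expr0n muln_eq0 subn_eq0 leqNgt (leq_trans (ltn_ord i)) ?leq_addr //.
  by rewrite mulr0.
have unitM : map_mx (horner_eval s) M \in unitmx.
  by rewrite unitmxE det_map_mx unitfE.
have sk0 : s ^+ k != 0 by rewrite expf_neq0.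
exists (torus s); apply/eqP; rewrite -subv0; apply/subvP => q; rewrite memv_cap memv0.
case/andP => qW /memv_imgP[p pU qE].
have coefq i : (i <= k)%N -> s ^+ k * (dehom q)`_i = s ^+ (2 * i) * (dehom p)`_i.
  by move=> le_ik; rewrite qE rhoE dehom_torus.
have le_b (i : 'I_b) : (i <= k)%N by rewrite -ltnS -ab ltn_addr.
have le_a (j : 'I_a) : (b + j <= k)%N by rewrite -ltnS -ab ltn_add2l.
have highq : coef_window a b q = coef_window b 0 q *m map_mx (horner_eval s) CX.
  apply/rowP => j; apply: (mulfI sk0); rewrite !mxE coefq //.
  have /rowP/(_ j) := highC p pU; rewrite !mxE => ->.
  rewrite !mulr_sumr; apply: eq_bigr => i _; rewrite !mxE /= /horner_eval.
  rewrite hornerZ hornerXn !add0n mulrA mulrA coefq //.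
  have le_ij : (i <= b + j)%N by rewrite (leq_trans (ltnW (ltn_ord i))) ?leq_addr.
  rewrite -{1}(subnKC le_ij) mulnDr exprD.
  by rewrite -!mulrA; congr (_ * _); rewrite mulrC -mulrA.
have lowq : coef_window b 0 q = 0.
  apply: (can_inj (mulmxK unitM)); rewrite mul0mx hornM mulmxBr mulmx1 mulmxA -highq.
  by rewrite -(lowD q qW) subrr.
by apply/eqP/highW => //; rewrite highq lowq mul0mx.
Qed.

Theorem sym_pow2_transversal : transversal_rep rho.
Proof.
apply: transversal_of_complementary => W U; rewrite dim_sym_pow2 addnC => dimWU.
have [g low] := low_general_position U.
have [h high] := high_general_position dimWU.
have [d disj] := torus_disjoint dimWU (dim_rep rho g U) (dim_rep rho h W) low high.
exists (h^-1 * (d * g))%g; apply/eqP; rewrite -dimv_eq0 -(dim_rep rho h).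
rewrite lker0_img_cap ?rep_lker0 // -limg_comp -linrepM mulgA mulgV mul1g.
by rewrite linrepM limg_comp disj dimv0.
Qed.

End GeneralPosition.

Theorem theorem4p5 (R : realType) (k : nat) (hk : (1 <= k)%N) :
  let V_k := sym_pow2_rep (complex R) k in
  irreducible_rep V_k /\ transversal_rep V_k /\ covering_complexity V_k = 1.
Proof.
move=> V_k.
have transv : transversal_rep V_k by exact/sym_pow2_transversal/pchar_num.
have V0 : fullv != 0%VS :> {vspace sym_pow2 (complex R) k}.
  by rewrite -dimv_eq0 dim_sym_pow2.
split; first exact: transversal_irreducible.
by split=> //; exact: transversal_covering_complexity.
Qed.
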